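(* Let $n\ge2$, let $f:2^{[n]}\to\mathbb{R}_+$ be monotone submodular, and let $\mathbf{x}\in[0,1]^n$ with $0\le x_1\le x_2\le\dots\le x_n\le1$. If either (i) $\sum_{i=1}^{n-1}x_i\le1$ and $x_n\le1/4$, or (ii) $\sum_{i=2}^{n}x_i\ge n-2$ and $x_1\ge3/4$, then $f^{+}(\mathbf{x})/f^{++}(\mathbf{x})\le4/3$ (with the convention $0/0=1$).
   Context: $[n]=\{1,\dots,n\}$. A set function $f:2^{[n]}\to\mathbb{R}_+$ is monotone if $f(S)\le f(T)$ for $S\subseteq T$, submodular if $f(S)+f(T)\ge f(S\cap T)+f(S\cup T)$. For $\mathbf{x}\in[0,1]^n$: the concave closure $f^{+}(\mathbf{x})=\max\sum_{S\subseteq[n]}\theta(S)f(S)$ over $\theta:2^{[n]}\to\mathbb{R}_{\ge0}$ with $\sum_S\theta(S)=1$ and $\sum_{S\ni i}\theta(S)=x_i$ for all $i$; the upper pairwise independent extension $f^{++}(\mathbf{x})$ is the same maximum with the additional constraints $\sum_{S\ni i,j}\theta(S)=x_ix_j$ for all $i<j$. *)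

(* Defs.v *)
From HB Require Import structures.
From mathcomp Require Import all_boot all_order all_algebra.
From mathcomp Require Import boolp classical_sets reals.
Set Implicit Arguments. Unset Strict Implicit. Unset Printing Implicit Defensive.
Import Order.TTheory GRing.Theory Num.Theory.
Local Open Scope ring_scope.
Local Open Scope classical_set_scope.

(* Ground set [n] is represented by 'I_n (0-indexed: x_1 is x at index 0). *)

Definition monotone_setfun (R : realType) (n : nat) (f : {set 'I_n} -> R) :=
  forall S T : {set 'I_n}, S \subset T -> f S <= f T.

Definition submodular (R : realType) (n : nat) (f : {set 'I_n} -> R) :=
  forall S T : {set 'I_n}, f (S :&: T) + f (S :|: T) <= f S + f T.

Definition marg_feasible (R : realType) (n : nat) (x : 'I_n -> R)
  (theta : {set 'I_n} -> R) :=
  [/\ forall S, 0 <= theta S,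
      \sum_(S : {set 'I_n}) theta S = 1 &
      forall i : 'I_n, \sum_(S : {set 'I_n} | i \in S) theta S = x i].

Definition pairwise_feasible (R : realType) (n : nat) (x : 'I_n -> R)
  (theta : {set 'I_n} -> R) :=
  marg_feasible x theta /\
  forall i j : 'I_n, (i < j)%N ->
    \sum_(S : {set 'I_n} | (i \in S) && (j \in S)) theta S = x i * x j.

Definition lp_value (R : realType) (n : nat) (f : {set 'I_n} -> R)
  (theta : {set 'I_n} -> R) := \sum_(S : {set 'I_n}) theta S * f S.

(* concave closure f^+(x): the maximum of the LP, written as a supremum *)
Definition concave_closure (R : realType) (n : nat) (f : {set 'I_n} -> R)
  (x : 'I_n -> R) : R :=
  sup [set v | exists theta, marg_feasible x theta /\ v = lp_value f theta].

Definition upper_pairwise_ext (R : realType) (n : nat) (f : {set 'I_n} -> R)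
  (x : 'I_n -> R) : R :=
  sup [set v | exists theta, pairwise_feasible x theta /\ v = lp_value f theta].

(* Main.v *)
Require Import Defs.
From HB Require Import structures.
From mathcomp Require Import all_boot all_order all_algebra.
From mathcomp Require Import boolp classical_sets reals.
From mathcomp Require Import ring lra.
Import Order.TTheory GRing.Theory Num.Theory.
Local Open Scope ring_scope.

(* Let [m] be the index of the largest marginal, with [sum_(i != m) x i <= 1].
   There is an explicit pairwise independent distribution, the star
   distribution centred at [m], under which sets avoiding [m] have at most one
   element, and which gives [f] at least
   [f set0 + (1 - x m) * sum_i x i * (f {i} - f set0)]. By submodularity
   [f^+ x <= f set0 + sum_i x i * (f {i} - f set0)], so [x m <= 1/4] gives the
   ratio [4/3]. In the second case, take the complement of a star-distributed
   set for the marginals [1 - x i]; its value is at least [x_1 * f setT], while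
   [f^+ x <= f setT] by monotonicity. *)

Section Expectation.
Set Implicit Arguments.
Unset Strict Implicit.
Variables (R : realType) (n : nat).
Implicit Types (f g : {set 'I_n} -> R) (x y : 'I_n -> R).
Implicit Types theta : {set 'I_n} -> R.

(** * Values of set functions under a distribution; complements *)

Lemma submodular_le_sum_singletons f (S : {set 'I_n}) : submodular f ->
  f S <= f (finset.set0) + \sum_(i in S) (f [set i]%SET - f (finset.set0)).
Proof.
move=> sf; have [k] := ubnP #|S|; elim: k S => // k IH S.
have [->|[i iS]] := set_0Vmem S; first by rewrite big_set0 addr0.
rewrite ltnS (cardsD1 i) iS add1n => /IH IHS.
have := sf (S :\ i)%SET [set i]%SET.
rewrite (big_setD1 i) //= finset.setUC finset.setD1K //.
have -> : ((S :\ i) :&: [set i])%SET = finset.set0.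
  by apply/setP => j; rewrite !inE; case: eqP; rewrite ?andbF.
by move: IHS; lra.
Qed.

Lemma submodular_setC f : submodular f -> submodular (fun S => f (~: S)%SET).
Proof.
move=> sf S T /=; rewrite finset.setCI finset.setCU [leLHS]addrC.
exact: sf.
Qed.

Lemma lp_value_indicator (P : pred {set 'I_n}) theta :
  lp_value (fun S => (P S)%:R) theta = \sum_(S | P S) theta S.
Proof.
rewrite /lp_value [RHS]big_mkcond; apply: eq_bigr => S _.
by case: (P S); rewrite ?mulr1 ?mulr0.
Qed.

(** By linearity only the marginals of [theta] enter, so a bound by such a function is uniform over
    all feasible [theta]. *)
Lemma lp_value_linear_eq (c : R) (a : 'I_n -> R) x theta :
  marg_feasible x theta ->
  lp_value (fun S => c + \sum_(i in S) a i) theta = c + \sum_i x i * a i.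
Proof.
case=> _ theta1 thetax; rewrite /lp_value.
under eq_bigr do rewrite mulrDr mulr_sumr big_mkcond.
rewrite big_split -mulr_suml theta1 mul1r /=; congr (_ + _).
rewrite exchange_big; apply: eq_bigr => i _.
by rewrite -big_mkcond -mulr_suml thetax.
Qed.

Lemma ler_lp_value f g theta : (forall S, 0 <= theta S) ->
  (forall S, f S <= g S) -> lp_value f theta <= lp_value g theta.
Proof. by move=> t0 fg; apply: ler_sum => S _; apply: ler_wpM2l. Qed.

Lemma lp_value_le_setT f x theta : monotone_setfun f ->
  marg_feasible x theta -> lp_value f theta <= f [set: 'I_n]%SET.
Proof.
move=> mf [t0 t1 _].
rewrite -[leRHS]mul1r -t1 mulr_suml; apply: ler_sum => S _.
by apply: ler_wpM2l => //; exact/mf/finset.subsetT.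
Qed.

Lemma lp_value_le_sum_singletons f x theta : submodular f ->
  marg_feasible x theta ->
  lp_value f theta <=
  f (finset.set0) + \sum_i x i * (f [set i]%SET - f (finset.set0)).
Proof.
move=> sf mt; rewrite -(lp_value_linear_eq _ _ mt).
apply: ler_lp_value => [|S]; first by case: mt.
exact: submodular_le_sum_singletons.
Qed.

Lemma lp_value_setC f theta :
  lp_value f (fun S => theta (~: S)%SET) = lp_value (fun S => f (~: S)%SET) theta.
Proof.
rewrite /lp_value (reindex_inj (@finset.setC_inj _)).
by apply: eq_bigr => S _; rewrite finset.setCK.
Qed.

(** Inclusion-exclusion on indicators: the probability of avoiding both [i] and [j] is
    [1 - x i - x j + x i * x j], which factors. *)
Lemma pairwise_feasible_setC x theta : pairwise_feasible x theta ->
  pairwise_feasible (fun i => 1 - x i) (fun S => theta (~: S)%SET).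
Proof.
case=> -[t0 t1 tx] txx; split; first split => //.
- by rewrite -t1 [RHS](reindex_inj (@finset.setC_inj _)).
- move=> i; rewrite -(lp_value_indicator (fun S => i \in S)) lp_value_setC.
  rewrite -[in RHS]t1 -tx -!lp_value_indicator /lp_value -sumrB.
  by apply: eq_bigr => S _; rewrite inE; case: (_ \in _) => /=; lra.
move=> i j ij.
rewrite -(lp_value_indicator (fun S => (i \in S) && (j \in S))) lp_value_setC.
have -> : (1 - x i) * (1 - x j) = 1 - x i - x j + x i * x j by ring.
rewrite -(txx _ _ ij) -[in RHS]t1 -!tx -!lp_value_indicator /lp_value.
rewrite -!sumrB -big_split; apply: eq_bigr => S _ /=; rewrite !inE.
by do 2 case: (_ \in _) => /=; lra.
Qed.

(** * Independent sampling *)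

Definition bernoulli_product (q : 'I_n -> R) (S : {set 'I_n}) : R :=
  \prod_i (if i \in S then q i else 1 - q i).

Lemma bernoulli_product_ge0 q S :
  (forall i, 0 <= q i <= 1) -> 0 <= bernoulli_product q S.
Proof.
move=> q01; apply: prodr_ge0 => i _; have /andP[? ?] := q01 i.
by case: ifP => _ //; rewrite subr_ge0.
Qed.

Lemma bernoulli_product_superset q (A : {set 'I_n}) :
  \sum_(S : {set 'I_n} | A \subset S) bernoulli_product q S =
  \prod_(i in A) q i.
Proof.
(* Expanding the product of [q i + r i] gives one term per set [S]; a zero factor kills those with
   [A] not inside [S]. *)
pose r i := if i \in A then 0 else 1 - q i.
transitivity (\prod_i (q i + r i)); last first.
  rewrite [RHS]big_mkcond; apply: eq_bigr => i _.
  by rewrite /r; case: ifP => _; rewrite ?addr0 // addrC subrK.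
rewrite bigA_distr big_mkcond; apply: eq_bigr => S _.
case: ifPn => [/fintype.subsetP AS|/subsetPn[i iA iS]].
  apply: eq_bigr => i _; rewrite /r; case: ifPn => // iS.
  by case: ifP => // /AS; rewrite (negbTE iS).
by rewrite (bigD1 i) //= (negbTE iS) /r iA mul0r.
Qed.


(** * The star distribution and its feasibility *)

Lemma lp_value_delta f (A : {set 'I_n}) :
  lp_value f (fun S => (S == A)%:R) = f A.
Proof.
rewrite /lp_value (bigD1 A) //= eqxx mul1r big1 ?addr0 // => S /negbTE->.
by rewrite mul0r.
Qed.

Definition star_ratio x (m i : 'I_n) : R := if i == m then 1 else x i / x m.

(* With probability [1 - x m] draw at most one element, different from [m],
   element [i] with probability [x i]; with probability [x m * (1 - x m)]
   draw [{m}]; with probability [x m ^+ 2] draw [m] together with each other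
   [i] independently with probability [x i / x m] (which is [0] if [x m = 0]).
   Pairs avoiding [m] are thus only drawn in the last case, where
   [x m ^+ 2 * (x i / x m) * (x j / x m) = x i * x j]. *)
Definition star_distribution x (m : 'I_n) (S : {set 'I_n}) : R :=
  (1 - x m) * (\sum_(i | i != m) x i * (S == [set i]%SET)%:R +
               (1 - \sum_(i | i != m) x i) * (S == finset.set0)%:R) +
  x m * (1 - x m) * (S == [set m]%SET)%:R +
  x m ^+ 2 * bernoulli_product (star_ratio x m) S.

Lemma lp_value_star_distribution f x m :
  lp_value f (star_distribution x m) =
  (1 - x m) * (\sum_(i | i != m) x i * f [set i]%SET +
               (1 - \sum_(i | i != m) x i) * f (finset.set0)) +
  x m * (1 - x m) * f [set m]%SET +
  x m ^+ 2 * lp_value f (bernoulli_product (star_ratio x m)).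
Proof.
rewrite -[f (finset.set0)]lp_value_delta -[f [set m]%SET]lp_value_delta.
under eq_bigr do rewrite -lp_value_delta mulr_sumr.
rewrite exchange_big /lp_value !mulr_sumr -big_split mulr_sumr -!big_split /=.
apply: eq_bigr => S _; rewrite /star_distribution.
under [in RHS]eq_bigr do rewrite mulrA; rewrite -mulr_suml.
by ring.
Qed.

Section StarDistribution.
Variables (x : 'I_n -> R) (m : 'I_n).
Hypotheses (x_ge0 : forall i, 0 <= x i) (x_le_m : forall i, x i <= x m).
Hypotheses (xm_le1 : x m <= 1) (sum_x_le1 : \sum_(i | i != m) x i <= 1).

Lemma star_ratio_ge0_le1 i : 0 <= star_ratio x m i <= 1.
Proof.
rewrite /star_ratio; case: eqP => _; first by rewrite ler01 lexx.
rewrite divr_ge0 //=; have [xm0|xm0] := eqVneq (x m) 0.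
  by rewrite xm0 invr0 mulr0 ler01.
by rewrite ler_pdivrMr ?mul1r // lt_def xm0 x_ge0.
Qed.

Lemma star_ratioM i : x m * star_ratio x m i = x i.
Proof.
rewrite /star_ratio; have [->|_] := eqVneq i m; rewrite ?mulr1 // mulrC.
have [xm0|xm0] := eqVneq (x m) 0; last by rewrite divfK.
by rewrite xm0 mulr0; apply/eqP; rewrite eq_le x_ge0 -xm0 x_le_m.
Qed.

Lemma star_distribution_ge0 S : 0 <= star_distribution x m S.
Proof.
have xm1 : 0 <= 1 - x m by rewrite subr_ge0.
have s1 : 0 <= 1 - \sum_(i | i != m) x i by rewrite subr_ge0.
rewrite /star_distribution !addr_ge0 ?mulr_ge0 ?exprn_ge0 //.
  by rewrite addr_ge0 ?mulr_ge0 // sumr_ge0 // => i _; rewrite mulr_ge0.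
exact/bernoulli_product_ge0/star_ratio_ge0_le1.
Qed.

(** Taking [A] empty, a singleton or a pair yields the total mass, the marginals and the pair
    probabilities. *)
Lemma star_distribution_superset (A : {set 'I_n}) :
  \sum_(S : {set 'I_n} | A \subset S) star_distribution x m S =
  (1 - x m) * (\sum_(i | i != m) x i * (A \subset [set i]%SET)%:R +
               (1 - \sum_(i | i != m) x i) * (A == finset.set0)%:R) +
  x m * (1 - x m) * (A \subset [set m]%SET)%:R +
  x m ^+ 2 * \prod_(i in A) star_ratio x m i.
Proof.
rewrite -lp_value_indicator lp_value_star_distribution lp_value_indicator.
by rewrite bernoulli_product_superset finset.subset0.
Qed.

Lemma star_distribution_feasible : pairwise_feasible x (star_distribution x m).
Proof.
have set10 (i : 'I_n) : ([set i]%SET == finset.set0) = false.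
  by apply/negbTE/set0Pn; exists i; rewrite inE.
split; first split; first exact: star_distribution_ge0.
- under eq_bigl => S do rewrite -(finset.sub0set S).
  rewrite star_distribution_superset eqxx finset.sub0set big_set0.
  under eq_bigr do rewrite finset.sub0set mulr1.
  by rewrite /=; ring.
- move=> i; under eq_bigl => S do rewrite -(finset.sub1set S i).
  rewrite star_distribution_superset set10 big_set1.
  under eq_bigr do rewrite finset.sub1set inE.
  rewrite finset.sub1set inE; have [->|im] := eqVneq i m.
    rewrite big1 /star_ratio ?eqxx => [|j /negbTE jm]; first by rewrite /=; ring.
    by rewrite eq_sym jm mulr0.
  rewrite (bigD1 i) //= eqxx big1 => [|j /andP[_ /negbTE ji]].
    by rewrite -(star_ratioM i) /=; ring.
  by rewrite eq_sym ji mulr0.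
move=> i j ij; have nij : i != j by rewrite -val_eqE neq_ltn ij.
have set2 k : ([set i; j]%SET \subset [set k]%SET) = false.
  apply/negbTE; rewrite finset.subUset !finset.sub1set !inE.
  by apply: contraNN nij => /andP[/eqP-> /eqP->].
under eq_bigl => S do rewrite -!finset.sub1set -finset.subUset.
rewrite star_distribution_superset set2 big1 => [|k _]; last first.
  by rewrite set2 mulr0.
have -> : ([set i; j]%SET == finset.set0) = false.
  by apply/negbTE/set0Pn; exists i; rewrite !inE eqxx.
rewrite finset.big_setU1 ?inE //= big_set1.
transitivity ((x m * star_ratio x m i) * (x m * star_ratio x m j));
  first by rewrite /=; ring.
by rewrite !star_ratioM.
Qed.

(** * Lower bounds on the value of the star distribution *)

Lemma lp_value_bernoulli_product_ge f c :
  (forall S : {set 'I_n}, m \in S -> c <= f S) ->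
  c <= lp_value f (bernoulli_product (star_ratio x m)).
Proof.
move=> cf.
have p0 S := bernoulli_product_ge0 S star_ratio_ge0_le1.
have p1 : \sum_(S : {set 'I_n} | true) bernoulli_product (star_ratio x m) S = 1.
  under eq_bigl => S do rewrite -(finset.sub0set S).
  by rewrite bernoulli_product_superset big_set0.
rewrite -[leLHS]mul1r -p1 mulr_suml; apply: ler_sum => S _.
have [mS|mS] := boolP (m \in S); first by rewrite ler_wpM2l ?cf.
(* The ratio at [m] is [1], so a set avoiding [m] has mass zero. *)
rewrite /bernoulli_product (bigD1 m) //= (negbTE mS) /star_ratio eqxx subrr.
by rewrite !mul0r.
Qed.

Lemma star_distribution_ge_singletons f : monotone_setfun f ->
  f (finset.set0) + (1 - x m) * \sum_i x i * (f [set i]%SET - f (finset.set0))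
  <= lp_value f (star_distribution x m).
Proof.
move=> mf; rewrite lp_value_star_distribution (bigD1 m) //=.
under eq_bigr do rewrite mulrBr; rewrite sumrB -mulr_suml.
have /(ler_wpM2l (exprn_ge0 2 (x_ge0 m))) :
    f [set m]%SET <= lp_value f (bernoulli_product (star_ratio x m)).
  apply: lp_value_bernoulli_product_ge => S mS.
  by apply: mf; rewrite finset.sub1set.
(* Once the product part is bounded by [f [set m]], this quantity is exactly the slack in the
   goal. *)
have : 0 <= x m ^+ 2 * (f [set m]%SET - f (finset.set0)).
  by rewrite mulr_ge0 ?exprn_ge0 // subr_ge0 mf // finset.sub0set.
set p := x m; set s := \sum_(i | _) x i; set a := f (finset.set0).
set u := \sum_(i | _) _; set b := f [set m]%SET; set e := lp_value _ _.
nra.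
Qed.

(* Submodularity bounds the sum of the losses [f setT - f (~: [set i])] by
   [f setT]; the loss for [i] is weighted by at most [x m * (1 - x m)], and the
   product part of the distribution is bounded below by [0]. *)
Lemma star_distribution_setC_ge f :
  (forall S, 0 <= f S) -> monotone_setfun f -> submodular f ->
  (1 - x m) * f [set: 'I_n]%SET <=
  lp_value (fun S => f (~: S)%SET) (star_distribution x m).
Proof.
move=> f0 mf sf; rewrite lp_value_star_distribution /= finset.setC0.
set F := f [set: 'I_n]%SET.
have := submodular_le_sum_singletons [set: 'I_n]%SET (submodular_setC sf).
rewrite /= finset.setCT finset.setC0 -/F (bigD1 m) ?inE //=.
rewrite (eq_bigl (fun i => i != m)); last by move=> i; rewrite inE.
have f00 := f0 (finset.set0).
have : 0 <= lp_value (fun S => f (~: S)%SET) (bernoulli_product (star_ratio x m)).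
  exact: lp_value_bernoulli_product_ge.
set e := lp_value _ _ => e0 le_loss.
have mono i : f (~: [set i])%SET <= F.
  exact/mf/finset.subsetT.
have le_u : x m * \sum_(i | i != m) (f (~: [set i])%SET - F) <=
    \sum_(i | i != m) x i * f (~: [set i])%SET - (\sum_(i | i != m) x i) * F.
  rewrite mulr_suml -sumrB mulr_sumr; apply: ler_sum => i _.
  rewrite -mulrBr ler_wnM2r ?subr_le0 //.
move: le_loss le_u; set u := \sum_(i | _) _; set v := \sum_(i | _) _ * _.
set s := \sum_(i | _) x i; set b := f [set~ m]%SET; set p := x m => le_loss le_u.
have p0 : 0 <= p := x_ge0 m; have p1 : 0 <= 1 - p by rewrite subr_ge0.
have : 0 <= p ^+ 2 * e by rewrite mulr_ge0 ?exprn_ge0.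
(* The value equals [(1 - p) * (F + (v - s * F + p * b)) + p ^+ 2 * e]. The inner term is at least
   [p * (b + u)], and [b + u] is at least [f set0]. *)
have /(ler_wpM2l p1) : 0 <= v - s * F + p * b.
  have bu : 0 <= b + u by lra.
  by have := mulr_ge0 p0 bu; lra.
nra.
Qed.

End StarDistribution.

End Expectation.

(** * From one good feasible point to the ratio bound *)

Lemma concave_closure_le_of_feasible (R : realType) (n : nat)
    (f : {set 'I_n} -> R) (x : 'I_n -> R) (c : R) (theta : {set 'I_n} -> R) :
  0 <= c -> monotone_setfun f -> pairwise_feasible x theta ->
  (forall eta, marg_feasible x eta -> lp_value f eta <= c * lp_value f theta) ->
  concave_closure f x <= c * upper_pairwise_ext f x.
Proof.
move=> c0 mf pt le_eta; apply: (@le_trans _ _ (c * lp_value f theta)).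
  apply: ge_sup => [|_ [eta [mt ->]]]; last exact: le_eta.
  by exists (lp_value f theta), theta; split=> //; case: pt.
apply: ler_wpM2l => //; apply: ub_le_sup; last by exists theta.
(* Monotonicity bounds all values by [f setT], so the supremum is a genuine upper bound. *)
exists (f [set: 'I_n]%SET) => _ [eta [[mt _] ->]].
exact: lp_value_le_setT mt.
Qed.

Theorem mainTheorem11 (R : realType) (n : nat) (f : {set 'I_n} -> R)
  (x : 'I_n -> R) :
  (2 <= n)%N ->
  (forall S, 0 <= f S) -> monotone_setfun f -> submodular f ->
  (forall i, 0 <= x i /\ x i <= 1) ->
  (forall i j : 'I_n, (i <= j)%N -> x i <= x j) ->
  ((\sum_(i : 'I_n | (i < n.-1)%N) x i <= 1 /\
      forall i : 'I_n, val i = n.-1 -> x i <= 1 / 4)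
   \/
   (\sum_(i : 'I_n | (0 < i)%N) x i >= (n%:R - 2) /\
      forall i : 'I_n, val i = 0%N -> x i >= 3 / 4)) ->
  concave_closure f x <= 4 / 3 * upper_pairwise_ext f x.
Proof.
case: n f x => // n f x _ f0 mf sf x01 xmono.
have c0 : 0 <= 4 / 3 :> R by lra.
have x0 i : 0 <= x i by case: (x01 i).
case=> [[sum_le /(_ ord_max erefl) xm]|[sum_ge /(_ ord0 erefl) xm]].
- have x_le_m i : x i <= x ord_max by apply: xmono; rewrite -ltnS.
  have xm1 : x ord_max <= 1 by case: (x01 ord_max).
  have sum_le1 : \sum_(i | i != ord_max) x i <= 1.
    rewrite (eq_bigl (fun i : 'I_n.+1 => (i < n)%N)) // => i.
    by rewrite -val_eqE ltn_neqAle -ltnS ltn_ord andbT.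
  apply: (concave_closure_le_of_feasible c0 mf
    (star_distribution_feasible x0 x_le_m xm1 sum_le1)) => eta mt.
  have := lp_value_le_sum_singletons sf mt.
  have := star_distribution_ge_singletons x0 x_le_m mf.
  have : 0 <= \sum_i x i * (f [set i]%SET - f (finset.set0)).
    apply: sumr_ge0 => i _; rewrite mulr_ge0 // subr_ge0.
    exact/mf/finset.sub0set.
  (* Since [1 - x ord_max] is at least [3 / 4], the factor [4 / 3] restores the full weight of
     [u]. *)
  by have := f0 finset.set0; set u := \sum_i _; move: (x0 ord_max); nra.
pose y i := 1 - x i.
have y0 i : 0 <= y i by rewrite subr_ge0; case: (x01 i).
have y_le_m i : y i <= y ord0 by rewrite lerB // xmono.
have ym1 : y ord0 <= 1 by rewrite gerBl.
(* The ground set now has [n.+1] elements, [n] of them not [ord0], so the sum is at most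
   [n - (n.+1 - 2) = 1]. *)
have sum_le1 : \sum_(i | i != ord0) y i <= 1.
  rewrite (eq_bigl (fun i : 'I_n.+1 => (0 < i)%N)); last first.
    by move=> i; rewrite -val_eqE lt0n.
  rewrite sumrB.
  have -> : \sum_(i < n.+1 | (0 < i)%N) 1 = n%:R :> R.
    by rewrite big_mkcond big_ord_recl /= add0r sumr_const card_ord.
  by move: sum_ge; rewrite -natr1; lra.
have pt := pairwise_feasible_setC
  (star_distribution_feasible y0 y_le_m ym1 sum_le1).
rewrite (_ : (fun i => 1 - y i) = x) in pt; last first.
  by apply/funext => i; rewrite /y subKr.
apply: (concave_closure_le_of_feasible c0 mf pt) => eta mt.
rewrite lp_value_setC; have := lp_value_le_setT mf mt.
have := star_distribution_setC_ge y0 y_le_m ym1 f0 mf sf.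
by have := f0 [set: 'I_n.+1]%SET; rewrite /y; nra.
Qed.
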